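(* Let $\mathbb{K}$ be a field of characteristic zero, let $\mathcal{S}_2$ be the algebra of all commutative $2$-dimensional algebras with trace zero multiplication over $\mathbb{K}$, and let $d:\mathcal{S}_2\to\mathcal{S}_2$ be a linear map. Then $d$ is a $\frac12$-derivation of $\mathcal{S}_2$ if and only if there exists a scalar $\lambda\in\mathbb{K}$ such that $d(x)=\lambda x$ for all $x\in\mathcal{S}_2$.
   Context: Algebras are vector spaces over $\mathbb{K}$ with a bilinear multiplication; they need not be associative, commutative or unital. The algebra $\mathcal{S}_2$ is the $4$-dimensional algebra over $\mathbb{K}$ with basis $z_1,z_2,z_3,z_4$ and the following multiplication (left factor first; all products of basis elements not listed are $0$): $z_1z_1=-z_1$, $z_1z_2=z_2$, $z_1z_3=3z_3$, $z_1z_4=-3z_4$; $z_2z_1=-2z_2$, $z_2z_2=-3z_3$, $z_2z_4=z_1$; $z_4z_1=3z_4$, $z_4z_2=-2z_1$, $z_4z_3=-z_2$. A linear map $d:\mathcal{A}\to\mathcal{A}$ on an algebra $\mathcal{A}$ is a $\frac12$-derivation if $d(xy)=\frac12\big(d(x)y+x\,d(y)\big)$ for all $x,y\in\mathcal{A}$. *)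

(* Defs.v *)
From HB Require Import structures.
From mathcomp Require Import all_boot all_order all_algebra.

Set Implicit Arguments.
Unset Strict Implicit.
Unset Printing Implicit Defensive.

Import GRing.Theory.
Local Open Scope ring_scope.

(* An algebra over K (not necessarily associative, commutative or unital) is a
   vector space V together with a bilinear map mul. *)
Definition half_derivation (K : fieldType) (V : lmodType K)
    (mul : {bilinear V -> V -> V}) (d : {linear V -> V}) : Prop :=
  forall x y : V, d (mul x y) = 2%:R^-1 *: (mul (d x) y + mul x (d y)).

Section S2.

Variable K : fieldType.

(* The basis vector z_k for k = 1, .., 4 lies at coordinate k - 1. *)
Definition S2_basis (k : nat) : 'rV[K]_4 := delta_mx 0 (inord k.-1).

Local Notation z := S2_basis.

Definition S2_table (k l : nat) : 'rV[K]_4 :=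
  match k, l with
  | 1, 1 => - z 1
  | 1, 2 => z 2
  | 1, 3 => 3%:R *: z 3
  | 1, 4 => - (3%:R *: z 4)
  | 2, 1 => - (2%:R *: z 2)
  | 2, 2 => - (3%:R *: z 3)
  | 2, 4 => z 1
  | 4, 1 => 3%:R *: z 4
  | 4, 2 => - (2%:R *: z 1)
  | 4, 3 => - z 2
  | _, _ => 0
  end.

Definition S2_mul (x y : 'rV[K]_4) : 'rV[K]_4 :=
  \sum_(i < 4) \sum_(j < 4) (x 0 i * y 0 j) *: S2_table i.+1 j.+1.

Fact S2_mul_is_bilinear :
  bilinear_for *:%R *:%R (S2_mul : 'rV[K]_4 -> 'rV[K]_4 -> 'rV[K]_4).
Proof.
split=> [y|x] a u v /=; rewrite /applyr /S2_mul.
- rewrite scaler_sumr -big_split; apply: eq_bigr => i _ /=.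
  rewrite scaler_sumr -big_split; apply: eq_bigr => j _ /=.
  by rewrite scalerA -scalerDl !mxE mulrDl mulrA.
- rewrite scaler_sumr -big_split; apply: eq_bigr => i _ /=.
  rewrite scaler_sumr -big_split; apply: eq_bigr => j _ /=.
  by rewrite scalerA -scalerDl !mxE mulrDr mulrCA.
Qed.

HB.instance Definition _ := bilinear_isBilinear.Build K 'rV[K]_4 'rV[K]_4
  'rV[K]_4 *:%R *:%R S2_mul S2_mul_is_bilinear.

Fact S2_mul_basis (k l : nat) : (0 < k <= 4)%N -> (0 < l <= 4)%N ->
  S2_mul (z k) (z l) = S2_table k l.
Proof.
move=> /andP[k_gt0 k_le4] /andP[l_gt0 l_le4].
have kE : (inord k.-1 : 'I_4).+1 = k by rewrite inordK prednK.
have lE : (inord l.-1 : 'I_4).+1 = l by rewrite inordK prednK.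
have zE m j : z m 0 j = (j == inord m.-1)%:R by rewrite mxE eqxx.
rewrite /S2_mul; move: S2_table => T.
rewrite (bigD1 (inord k.-1)) //= [X in _ + X]big1 ?addr0; last first.
  by move=> i ik; apply: big1 => j _; rewrite zE (negPf ik) mul0r scale0r.
rewrite (bigD1 (inord l.-1)) //= big1 ?addr0; last first.
  by move=> j jl; rewrite !zE (negPf jl) mulr0 scale0r.
by rewrite !zE !eqxx mulr1 scale1r kE lE.
Qed.

End S2.

(* Main.v *)
Require Import Defs.
From mathcomp Require Import all_boot all_order all_algebra.
From mathcomp Require Import ring.

Set Implicit Arguments.
Unset Strict Implicit.
Unset Printing Implicit Defensive.

Import GRing.Theory.
Local Open Scope ring_scope.

(** Multiplication by [z_1] is diagonal in the basis [z_1, .., z_4], on either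
    side, with integer eigenvalues: on the left [m = (-1, 1, 3, -3)], on the
    right [r = (-1, -2, 0, 3)].  This alone determines every
    1/2-derivation [d].

    Applying [d] to [z_1 z_1 = - z_1] shows that the [i]-th coordinate [a_i] of
    [d z_1] satisfies [(m_i + r_i + 2) a_i = 0]; since [m_i + r_i + 2] is
    nonzero for [i <> 1], [d z_1] is a multiple [lambda z_1].  Applying [d] to
    [z_1 x] then gives [2 d (z_1 x) = z_1 (lambda x + d x)], so that
    [e = d - lambda] satisfies [2 e (z_1 x) = z_1 (e x)].  For [x = z_j] this
    says that [e z_j] is killed by the diagonal operator with entries
    [2 m_j - m_i]; the double of an eigenvalue of [z_1] is never an eigenvalue,
    so [e z_j = 0].  In characteristic zero the integers [2 m_j - m_i] and
    [m_i + r_i + 2] remain nonzero in [K].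

    The converse is bilinearity together with [2 <> 0] in [K]. *)

Lemma intr_neq0_pchar0 (K : fieldType) (n : int) :
  [pchar K] =i pred0 -> n != 0 -> n%:~R != 0 :> K.
Proof.
move=> /pcharf0P K0; case: n => n n0; first by rewrite K0.
by rewrite NegzE mulrNz oppr_eq0 K0.
Qed.

Section BasisCoordinates.

Variable K : fieldType.

Local Notation z := (S2_basis K).

Lemma S2_basis_ord (j : 'I_4) : z j.+1 = delta_mx 0 j.
Proof. by rewrite /S2_basis /= inord_val. Qed.

Lemma diagonal_coord (f : {linear 'rV[K]_4 -> 'rV[K]_4}) (c : 'I_4 -> K) :
  (forall j : 'I_4, f (z j.+1) = c j *: z j.+1) ->
  forall x i, f x 0 i = c i * x 0 i.
Proof.
move=> fz x i; rewrite {1}[x]row_sum_delta linear_sum summxE (bigD1 i) //=.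
rewrite big1 ?addr0 => [|j ji]; rewrite linearZ -S2_basis_ord fz S2_basis_ord.
  by rewrite !mxE !eqxx mulr1 mulrC.
by rewrite !mxE eq_sym (negPf ji) andbF !mulr0.
Qed.

End BasisCoordinates.

(** The eigenvalues are kept as integers so that the non-resonance facts below
    are decided by computation, before any passage to [K]. *)
Definition z1_left_eigenvalue (i : 'I_4) : int := nth 0 [:: -1; 1; 3; -3] i.
Definition z1_right_eigenvalue (i : 'I_4) : int := nth 0 [:: -1; -2; 0; 3] i.

(** For [i = j] this says that no eigenvalue is zero: left multiplication by
    [z_1] is invertible. *)
Lemma double_left_eigenvalue_neq (i j : 'I_4) :
  z1_left_eigenvalue j *+ 2 - z1_left_eigenvalue i != 0.
Proof. by case: i => -[|[|[|[|[]]]]] // ?; case: j => -[|[|[|[|[]]]]]. Qed.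

Lemma sum_eigenvalues_neq (i : 'I_4) :
  i != 0 -> z1_left_eigenvalue i + z1_right_eigenvalue i + 2 != 0.
Proof. by case: i => -[|[|[|[|[]]]]]. Qed.

Section MultiplicationByZ1.

Variable K : fieldType.

Local Notation z := (S2_basis K).
Local Notation m := z1_left_eigenvalue.
Local Notation r := z1_right_eigenvalue.

Lemma S2_mul_z1_basis (j : 'I_4) :
  S2_mul (z 1) (z j.+1) = (m j)%:~R *: z j.+1.
Proof.
rewrite S2_mul_basis ?ltn_ord //.
by case: j => -[|[|[|[|[]]]]] // ?;
  rewrite /z1_left_eigenvalue /= ?mulrNz ?scaleNr ?scale1r.
Qed.

Lemma S2_mul_basis_z1 (j : 'I_4) :
  S2_mul (z j.+1) (z 1) = (r j)%:~R *: z j.+1.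
Proof.
rewrite S2_mul_basis ?ltn_ord //.
by case: j => -[|[|[|[|[]]]]] // ?;
  rewrite /z1_right_eigenvalue /= ?mulrNz ?scaleNr ?scale1r ?scale0r.
Qed.

Lemma S2_mul_z1_coord (x : 'rV[K]_4) i :
  S2_mul (z 1) x 0 i = (m i)%:~R * x 0 i.
Proof.
pose mul : {bilinear 'rV[K]_4 -> 'rV[K]_4 -> 'rV[K]_4} := @S2_mul K.
exact: (@diagonal_coord _ (mul (z 1)) (fun i => (m i)%:~R)
  S2_mul_z1_basis x i).
Qed.

Lemma S2_mul_coord_z1 (x : 'rV[K]_4) i :
  S2_mul x (z 1) 0 i = (r i)%:~R * x 0 i.
Proof.
pose mul : {bilinear 'rV[K]_4 -> 'rV[K]_4 -> 'rV[K]_4} := @S2_mul K.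
exact: (@diagonal_coord _ (applyr mul (z 1)) (fun i => (r i)%:~R)
  S2_mul_basis_z1 x i).
Qed.

End MultiplicationByZ1.

Section HalfDerivations.

Variables (K : fieldType) (charK : [pchar K] =i pred0).
Variable d : {linear 'rV[K]_4 -> 'rV[K]_4}.
Hypothesis d_half : half_derivation (@S2_mul K) d.

Local Notation z := (S2_basis K).
Local Notation m := z1_left_eigenvalue.
Local Notation r := z1_right_eigenvalue.

Lemma half_derivation_double x y :
  2%:R *: d (S2_mul x y) = S2_mul (d x) y + S2_mul x (d y).
Proof.
have two_neq0 : 2%:R != 0 :> K by apply: (@intr_neq0_pchar0 K 2).
by rewrite d_half scalerA divff // scale1r.
Qed.

(** By [z_1 z_1 = - z_1], the integer [m_i + r_i + 2] kills the [i]-th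
    coordinate of [d z_1]; it vanishes only for [i] the index of [z_1]. *)
Lemma half_derivation_z1 : d (z 1) = d (z 1) 0 0 *: z 1.
Proof.
apply/rowP => i; rewrite (S2_basis_ord K 0) !mxE eqxx /= -(S2_basis_ord K 0).
have [-> | i_neq0] := eqVneq i 0; first by rewrite mulr1.
have /rowP/(_ i) := half_derivation_double (z 1) (z 1).
rewrite (S2_mul_z1_basis K 0) linearZ /= !mxE.
rewrite S2_mul_z1_coord S2_mul_coord_z1 => /eqP; rewrite eq_sym -subr_eq0.
rewrite [X in X == 0](_ : _ = (m i + r i + 2)%:~R * d (z 1) 0 i); last first.
  by rewrite !intrD mulrNz; ring.
rewrite mulf_eq0 (negPf (intr_neq0_pchar0 charK (sum_eigenvalues_neq i_neq0))).
by move=> /eqP ->; rewrite mulr0.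
Qed.

(** Left multiplication by [z_1] carries the scalar [d z_1 / z_1] over to every
    [z_j], because [2 m_j] is not an eigenvalue of it. *)
Lemma half_derivation_basis (j : 'I_4) :
  d (z j.+1) = d (z 1) 0 0 *: z j.+1.
Proof.
set lambda := d (z 1) 0 0.
have d_z1zj : 2%:R *: ((m j)%:~R *: d (z j.+1)) =
    lambda *: ((m j)%:~R *: z j.+1) + S2_mul (z 1) (d (z j.+1)).
  have := half_derivation_double (z 1) (z j.+1).
  rewrite half_derivation_z1 -/lambda.
  rewrite [S2_mul (_ *: _) _](linearZl_LR (@S2_mul K)) /=.
  by rewrite S2_mul_z1_basis linearZ.
apply/rowP => i; apply/eqP; rewrite -subr_eq0.
have zj_coord : (m j)%:~R * z j.+1 0 i = (m i)%:~R * z j.+1 0 i.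
  by rewrite -S2_mul_z1_coord S2_mul_z1_basis [RHS]mxE.
move/rowP/(_ i): d_z1zj; move: zj_coord.
move: (z j.+1) (d (z j.+1)) => v u v_coord.
rewrite !mxE S2_mul_z1_coord => u_coord.
have /eqP : (m j *+ 2 - m i)%:~R * (u 0 i - lambda * v 0 i) = 0.
  (* The hypothesis on [u], corrected by [lambda] times the one on [v], which
     replaces [m_j v_i] by [m_i v_i]. *)
  transitivity (2%:R * ((m j)%:~R * u 0 i)
      - (lambda * ((m j)%:~R * v 0 i) + (m i)%:~R * u 0 i)
      - lambda * ((m j)%:~R * v 0 i - (m i)%:~R * v 0 i)).
    by rewrite intrB mulr2n intrD; ring.
  by rewrite u_coord v_coord !subrr mulr0 subrr.
rewrite mulf_eq0.
by rewrite (negPf (intr_neq0_pchar0 charK (double_left_eigenvalue_neq i j))).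
Qed.

End HalfDerivations.

Theorem theorem3p1 (K : fieldType) (charK : [pchar K] =i pred0)
    (d : {linear 'rV[K]_4 -> 'rV[K]_4}) :
  half_derivation (@S2_mul K) d <->
  exists lambda : K, forall x : 'rV[K]_4, d x = lambda *: x.
Proof.
split=> [d_half | [lambda d_scalar] x y].
  exists (d (S2_basis K 1) 0 0) => x; apply/rowP => i; rewrite [RHS]mxE.
  exact: (diagonal_coord (half_derivation_basis charK d_half)).
rewrite !d_scalar linearZl_LR linearZr_LR /= -scalerDl scalerA -mulr2n.
have two_neq0 : 2%:R != 0 :> K by apply: (@intr_neq0_pchar0 K 2).
by rewrite -[lambda *+ 2]mulr_natl mulKf.
Qed.
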